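(* Let $f:[0,+\infty)\to(-\infty,0]$ be a smooth function with $f(0)=0$, $f'(t)<0$ for all $t\ge0$, and $\lim_{t\to+\infty}f(t)=-\infty$. Let $\mathcal{B}_0(T^2)\cong\mathbb{H}^2\times\mathbb{C}^*$ be the deformation space of properly convex $\mathbb{RP}^2$-structures on the torus, with coordinates $z=x+iy$ ($y>0$) and $w=u+iv\neq0$, endowed with the symplectic form $\boldsymbol{\omega}_f$ (defined in the context). Then the Hamiltonian system $(\mathcal{B}_0(T^2),\boldsymbol{\omega}_f,H_1)$ is completely integrable, with integrals of motion $$H_1(z,w)=\tfrac23 f\big(y^3|w|^2\big),\qquad H_2(z,w)=2\tfrac{x}{y}\big(1-f(y^3|w|^2)\big).$$
   Context: $\mathbb{H}^2=\{x+iy:y>0\}$ is the upper half-plane. The deformation space $\mathcal{B}_0(T^2)$ is identified with pairs $(J,q)$, where $J$ is a point of the Teichmuller space of $T^2$ (identified with $\mathbb{H}^2$) and $q\ne0$ is a $J$-holomorphic cubic differential on $T^2$, hence with $\mathbb{H}^2\times\mathbb{C}^*$. The symplectic form is $$\boldsymbol{\omega}_f=\big(-1+f-3f'y^3(u^2+v^2)\big)\frac{\mathrm{d}x\wedge\mathrm{d}y}{y^2}-\frac43 f'y^3\,\mathrm{d}u\wedge\mathrm{d}v-2y^2f'\Big(u(\mathrm{d}x\wedge\mathrm{d}u+\mathrm{d}y\wedge\mathrm{d}v)+v(\mathrm{d}u\wedge\mathrm{d}y-\mathrm{d}v\wedge\mathrm{d}x)\Big),$$ where $f,f'$ are evaluated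 at $y^3(u^2+v^2)$. The Hamiltonian vector field of a function $g$ is defined by $\boldsymbol{\omega}_f(\mathbb{X}_g,\cdot)=\mathrm{d}g$. A Hamiltonian system $(M,\omega,H)$ of dimension $2n$ is completely integrable if there are $n$ functions $f_1=H,\dots,f_n$ (integrals of motion) whose differentials are linearly independent at every point of $M$ and with $\omega(\mathbb{X}_{f_i},\mathbb{X}_{f_j})=0$ for all $i,j$. *)

(* Defs.v *)
From mathcomp Require Import all_boot all_order all_algebra.
From mathcomp Require Import all_classical all_reals all_analysis.

Set Implicit Arguments.
Unset Strict Implicit.
Unset Printing Implicit Defensive.

Import Order.TTheory GRing.Theory Num.Theory.
Import numFieldNormedType.Exports.

Local Open Scope classical_set_scope.
Local Open Scope ring_scope.

(* Derivative of a function on [0, +oo): the increments are restricted to those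
   that stay in the half-line, so this is the right derivative at 0 and the
   values of [f] at negative arguments are irrelevant. *)
Definition half_quotient (R : realType) (f : R -> R) (t h : R) : R :=
  h^-1 * (f (t + h) - f t).

Definition half_increments (R : realType) (t : R) : set_system R :=
  within [set h | 0 <= t + h] 0^'.

Definition half_derivable (R : realType) (f : R -> R) (t : R) : Prop :=
  cvg (half_quotient f t h @[h --> half_increments t]).

Definition half_derive (R : realType) (f : R -> R) (t : R) : R :=
  lim (half_quotient f t h @[h --> half_increments t]).

Definition half_smooth (R : realType) (f : R -> R) : Prop :=
  forall (k : nat) (t : R), 0 <= t ->
    half_derivable (iter k (@half_derive R) f) t.

Fixpoint Ck_on (R : realType) (m : nat) (k : nat) (U : set 'rV[R]_m)
    (g : 'rV[R]_m -> R) : Prop :=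
  match k with
  | 0%N => forall p, U p -> {for p, continuous g}
  | k'.+1 => (forall p, U p -> differentiable g p) /\
             forall X : 'rV[R]_m, Ck_on k' U (fun p => 'D_X g p)
  end.

Definition smooth_on (R : realType) (m : nat) (U : set 'rV[R]_m)
    (g : 'rV[R]_m -> R) : Prop :=
  forall k : nat, Ck_on k U g.

(* The phase space is an open subset of R^m, so every tangent space is R^m: a
   differential 2-form is [omega : point -> vector -> vector -> scalar]. *)

(* Exterior derivative, evaluated on constant (hence commuting) vector fields. *)
Definition ext_derive2 (R : realType) (m : nat)
    (omega : 'rV[R]_m -> 'rV[R]_m -> 'rV[R]_m -> R) (p X Y Z : 'rV[R]_m) : R :=
  'D_X (fun q => omega q Y Z) p - 'D_Y (fun q => omega q X Z) p
  + 'D_Z (fun q => omega q X Y) p.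

Record symplectic_on (R : realType) (m : nat) (M : set 'rV[R]_m)
    (omega : 'rV[R]_m -> 'rV[R]_m -> 'rV[R]_m -> R) : Prop := SymplecticOn {
  symp_open : open M;
  symp_linear : forall p, M p -> forall X, scalar (omega p X);
  symp_antisymmetric : forall p, M p -> forall X Y, omega p X Y = - omega p Y X;
  symp_smooth : forall X Y, smooth_on M (fun p => omega p X Y);
  symp_nondegenerate : forall p, M p ->
    forall X, (forall Y, omega p X Y = 0) -> X = 0;
  symp_closed : forall p, M p -> forall X Y Z, ext_derive2 omega p X Y Z = 0 }.

Definition hamiltonian_system (R : realType) (m : nat) (M : set 'rV[R]_m)
    (omega : 'rV[R]_m -> 'rV[R]_m -> 'rV[R]_m -> R) (H : 'rV[R]_m -> R) : Prop :=
  symplectic_on M omega /\ smooth_on M H.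

(* The vector X with omega(X, .) = dg at p; it exists and is unique as soon as
   [omega p] is a nondegenerate bilinear form. *)
Definition hamiltonian_field (R : realType) (m : nat)
    (omega : 'rV[R]_m -> 'rV[R]_m -> 'rV[R]_m -> R) (g : 'rV[R]_m -> R)
    (p : 'rV[R]_m) : 'rV[R]_m :=
  xget 0 [set X | forall Y, omega p X Y = 'd g p Y].

(* The half-dimension is written n.+1 so that the tuple F has a first element. *)
Record completely_integrable (R : realType) (m n : nat) (M : set 'rV[R]_m)
    (omega : 'rV[R]_m -> 'rV[R]_m -> 'rV[R]_m -> R) (H : 'rV[R]_m -> R)
    (F : n.+1.-tuple ('rV[R]_m -> R)) : Prop := CompletelyIntegrable {
  ci_dim : m = (2 * n.+1)%N;
  ci_system : hamiltonian_system M omega H;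
  ci_first : thead F = H;
  ci_smooth : forall i, smooth_on M (tnth F i);
  ci_independent : forall p, M p -> forall c : 'I_n.+1 -> R,
    (forall Y, \sum_i c i * 'd (tnth F i) p Y = 0) -> forall i, c i = 0;
  ci_involution : forall i j p, M p ->
    omega p (hamiltonian_field omega (tnth F i) p)
            (hamiltonian_field omega (tnth F j) p) = 0 }.

Section Torus.
Variable R : realType.
Implicit Types (f : R -> R) (p X Y : 'rV[R]_4).

(* The row vector (x, y, u, v) stands for (z, w) = (x + i y, u + i v).  These
   projections are also the coordinate 1-forms dx, dy, du, dv. *)
Definition cx p : R := p 0 (@Ordinal 4 0 isT).
Definition cy p : R := p 0 (@Ordinal 4 1 isT).
Definition cu p : R := p 0 (@Ordinal 4 2 isT).
Definition cv p : R := p 0 (@Ordinal 4 3 isT).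

Definition B0_torus : set 'rV[R]_4 :=
  [set p | 0 < cy p /\ ~ (cu p = 0 /\ cv p = 0)].

Definition wedge (a b : 'rV[R]_4 -> R) X Y : R := a X * b Y - a Y * b X.

(* y^3 |w|^2 *)
Definition y3w2 p : R := cy p ^+ 3 * (cu p ^+ 2 + cv p ^+ 2).

Definition omega_f f p X Y : R :=
  let y := cy p in let u := cu p in let v := cv p in
  let ft := f (y3w2 p) in let f't := half_derive f (y3w2 p) in
  (- 1 + ft - 3 * f't * y ^+ 3 * (u ^+ 2 + v ^+ 2))
    * (wedge cx cy X Y / y ^+ 2)
  - 4 / 3 * f't * y ^+ 3 * wedge cu cv X Y
  - 2 * y ^+ 2 * f't *
    (u * (wedge cx cu X Y + wedge cy cv X Y)
     + v * (wedge cu cy X Y - wedge cv cx X Y)).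

Definition H1 f p : R := 2 / 3 * f (y3w2 p).

Definition H2 f p : R := 2 * (cx p / cy p) * (1 - f (y3w2 p)).

End Torus.

Arguments B0_torus {R}.

(* Main.v *)
Require Import Defs.
From mathcomp Require Import all_boot all_order all_algebra.
From mathcomp Require Import all_classical all_reals all_analysis.
From mathcomp Require Import ring lra.
Import Order.TTheory GRing.Theory Num.Theory.
Import numFieldNormedType.Exports.
Local Open Scope classical_set_scope.
Local Open Scope ring_scope.

(** Write s = y^3 |w|^2 and let f, f', f'' be evaluated at s.  Both integrals
    are functions of x / y and s, and their involution comes from one symmetry:
    the rotation of w, generated by the vector field T = - v d_u + u d_v.

    Contracting T with the symplectic form kills the dx component and leaves
    (2/3) f' ds = dH1 ([omega_f_rotation], [rotation_hamiltonian_H1]), so T is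
    the Hamiltonian field of H1.  Since H2 depends only on x / y and s, which
    the rotation preserves, dH2(T) = 0 and the two integrals are in involution
    ([hamiltonian_fields_commute]).  They are independent because dH1 has no dx
    component, whereas that of dH2 is 2 (1 - f) / y > 0, and because the dy
    component of dH1 is 2 f' s / y < 0 ([H1_H2_independent]).

    That the form is symplectic on the phase space is a computation with three
    coefficients: it equals
      A dx /\ dy + B du /\ dv
        + C (u (dx /\ du + dy /\ dv) + v (du /\ dy - dv /\ dx)).
    Its Pfaffian A B - C^2 |w|^2 collapses to (4/3) f' y (1 - f), the terms in
    f'^2 cancelling, and this is negative since f <= 0 and f' < 0
    ([pfaffian_omega_f], [omega_f_nondegenerate]).  Closedness is an identity
    between the first derivatives of A, B, C, which the chain rule expresses
    through f, f' and f'' ([ext_derive2_omega_f]).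

    On the phase space s > 0, so f is only ever evaluated at interior points of
    the half-line, where the one-sided derivative is the ordinary one.
    Smoothness follows from closure of the class C^k on an open set under sums,
    products, inverses and composition with a smooth function of one
    variable. *)

(** * Directional derivatives *)

(** Differentiability is a condition on the germ; this is what makes the class
    C^k on an open set depend only on the values on that set. *)
Lemma near_eq_is_diff {K : numFieldType} {V W : normedModType K}
    {f g df : V -> W} {x : V} :
  {near x, f =1 g} -> is_diff x f df -> is_diff x g df.
Proof.
move=> fg [fx <-].
have gE : g \o shift x = cst (g x) + 'd f x +o_ 0 id.
  apply/eqaddoP => e e0; have /eqaddoP/(_ e e0) := diff_locally fx.
  have : \forall h \near 0, f (h + x) = g (h + x).
    have : nbhs x [set y | f y = g y] by [].
    by rewrite [X in X -> _](near_shift 0 x) subr0.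
  apply: filterS2 => h /= fgh.
  by rewrite !fctE /= fgh (nbhs_singleton fg).
have dg : 'd g x = 'd f x :> (V -> W).
  by apply: diff_unique gE; exact: diff_continuous.
split=> //; apply/diff_locallyP; rewrite dg; split=> //.
exact: diff_continuous.
Qed.

Lemma is_diff_coord {K : realType} {n : nat} (p : 'rV[K]_n) (i : 'I_n) :
  is_diff p (fun q : 'rV[K]_n => q 0 i) (fun X => X 0 i).
Proof.
split; first exact: differentiable_coord.
have @c : {linear 'rV[K]_n -> K}.
  by exists (fun q : 'rV[K]_n => q 0 i); do 2![eexists]; do ?[constructor];
     rewrite ?mxE// => ? *; rewrite ?mxE//; move=> ?; rewrite !mxE.
rewrite (_ : (fun _ => _) = c) // diff_lin //; exact: coord_continuous.
Qed.

Lemma is_derive_coord {K : realType} {n : nat} (p X : 'rV[K]_n) (i : 'I_n) :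
  is_derive p X (fun q : 'rV[K]_n => q 0 i) (X 0 i).
Proof.
have [d dE] := is_diff_coord p i; split; first exact: diff_derivable.
by rewrite deriveE // dE.
Qed.

Lemma is_derive_comp_real {R : realType} {V : normedModType R} {phi : R -> R}
    {g : V -> R} {a b : R} {p X : V} :
  differentiable g p -> is_derive p X g b -> is_derive (g p) 1 phi a ->
  is_derive p X (phi \o g) (a * b).
Proof.
move=> dg [_ <-] [/derivable1_diffP dphi <-].
have dc : differentiable (phi \o g) p by exact: differentiable_comp.
split; first exact: diff_derivable.
by rewrite deriveE // diff_comp //= diff1E // derive1E -deriveE // mulrC.
Qed.

Lemma is_derive_inv {R : realType} {V : normedModType R} {g : V -> R} {a : R}
    {p X : V} : g p != 0 -> is_derive p X g a ->
  is_derive p X (fun q => (g q)^-1) (- a / g p ^+ 2).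
Proof.
move=> g0 [dg <-]; split; first exact: derivableV.
by rewrite deriveV // [LHS]mulrC mulrN mulNr.
Qed.

(** * Functions of class C^k on an open set *)

Section Ck.
Context {R : realType} {m : nat} {U : set 'rV[R]_m}.
Hypothesis openU : open U.
Implicit Types (g h : 'rV[R]_m -> R) (k : nat).

Lemma open_eq_near {g h p} : {in U, g =1 h} -> U p -> {near p, g =1 h}.
Proof.
move=> gh Up; have := open_nbhs_nbhs (conj openU Up).
by apply: filterS => q Uq; apply: gh; rewrite inE.
Qed.

(** The derivative rules of sums, products, inverses and compositions hold only
    at points of [U]: in the closure properties below, a directional derivative
    is replaced by the formula that it satisfies on [U]. *)
Lemma Ck_on_eq {k g h} : {in U, g =1 h} -> Ck_on k U g -> Ck_on k U h.
Proof.
elim: k g h => [|k IH] g h gh /=.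
  move=> cg p Up; have gh_p := open_eq_near gh Up.
  rewrite /prop_for /continuous_at -(nbhs_singleton gh_p).
  exact: cvg_trans (near_eq_cvg gh_p) (cg p Up).
move=> [dg Dg]; split=> [p Up|X].
  by have [] := near_eq_is_diff (open_eq_near gh Up) (differentiableP (dg p Up)).
apply: IH (Dg X) => p /set_mem Up.
exact/near_eq_derive/open_eq_near.
Qed.

Lemma Ck_on_lower {k g} : Ck_on k.+1 U g -> Ck_on k U g.
Proof.
elim: k g => [|k IH] g /= [dg Dg]; last by split=> // X; apply: IH.
by move=> p Up; apply: differentiable_continuous; apply: dg.
Qed.

Lemma Ck_on_cst k (a : R) : Ck_on k U (cst a).
Proof.
elim: k a => [|k IH] a /=; first by move=> p _; exact: cst_continuous.
split=> [p _|X]; first exact: differentiable_cst.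
by rewrite (_ : (fun p => _) = cst 0)//; apply/funext => p; rewrite derive_cst.
Qed.

Lemma Ck_on_coord k (i : 'I_m) : Ck_on k U (fun p => p 0 i).
Proof.
case: k => [|k] /=.
  by move=> p _; apply: differentiable_continuous; exact: differentiable_coord.
split=> [p _|X]; first exact: differentiable_coord.
rewrite (_ : (fun p => _) = cst (X 0 i)); first exact: Ck_on_cst.
by apply/funext => p; have [_ ->] := is_derive_coord p X i.
Qed.

Lemma Ck_onD {k g h} : Ck_on k U g -> Ck_on k U h ->
  Ck_on k U (fun p => g p + h p).
Proof.
elim: k g h => [|k IH] g h /=.
  by move=> cg ch p Up; apply: continuousD; [exact: cg|exact: ch].
move=> [dg Dg] [dh Dh]; split=> [p Up|X].
  by apply: differentiableD; [exact: dg|exact: dh].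
apply: Ck_on_eq (IH _ _ (Dg X) (Dh X)) => p /set_mem Up.
by rewrite deriveD //; apply: diff_derivable; [exact: dg|exact: dh].
Qed.

Lemma Ck_onM {k g h} : Ck_on k U g -> Ck_on k U h ->
  Ck_on k U (fun p => g p * h p).
Proof.
elim: k g h => [|k IH] g h.
  by move=> cg ch p Up; apply: continuousM; [exact: cg|exact: ch].
move=> Cg Ch; have [dg Dg] := Cg; have [dh Dh] := Ch.
split=> [p Up|X].
  by apply: differentiableM; [exact: dg|exact: dh].
apply: Ck_on_eq (Ck_onD (IH _ _ (Ck_on_lower Cg) (Dh X))
                        (IH _ _ (Ck_on_lower Ch) (Dg X))) => p /set_mem Up.
by rewrite deriveM //; apply: diff_derivable; [exact: dg|exact: dh].
Qed.

Lemma Ck_onV {k g} : (forall p, U p -> g p != 0) -> Ck_on k U g ->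
  Ck_on k U (fun p => (g p)^-1).
Proof.
move=> g0; elim: k => [|k IH] Cg.
  by move=> p Up; apply: continuousV; [exact: g0|exact: Cg].
have [dg Dg] := Cg; split=> [p Up|X].
  by apply: differentiableV; [exact: dg|exact: g0].
have CV := IH (Ck_on_lower Cg).
apply: Ck_on_eq (Ck_onM (Ck_on_cst k (-1)) (Ck_onM (Ck_onM CV CV) (Dg X))).
move=> p /set_mem Up.
rewrite deriveV ?g0//; last by apply: diff_derivable; exact: dg.
by rewrite !fctE /= mulN1r scaleNr -exprVn expr2.
Qed.

(** A whole sequence of successive derivatives is needed: the derivative of
    [F n \o g] involves [F n.+1 \o g], so the induction on [k] must range over
    all [n]. *)
Lemma Ck_on_comp {k} {F : nat -> R -> R} {D : set R} {g} :
  (forall n t, D t -> is_derive t 1 (F n) (F n.+1 t)) ->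
  (forall p, U p -> D (g p)) -> Ck_on k U g ->
  forall n, Ck_on k U (F n \o g).
Proof.
move=> dF gD; elim: k => [|k IH] Cg n.
  move=> p Up; apply: continuous_comp; first exact: Cg.
  apply: differentiable_continuous; apply/derivable1_diffP.
  by have [] := dF n _ (gD p Up).
have [dg Dg] := Cg.
split=> [p Up|X].
  apply: differentiable_comp; first exact: dg.
  by apply/derivable1_diffP; have [] := dF n _ (gD p Up).
apply: Ck_on_eq (Ck_onM (IH (Ck_on_lower Cg) n.+1) (Dg X)) => p /set_mem Up.
have DgX := derivableP (diff_derivable (v := X) (dg p Up)).
by have [_ ->] := is_derive_comp_real (dg p Up) DgX (dF n _ (gD p Up)).
Qed.

Lemma Ck_onN {k g} : Ck_on k U g -> Ck_on k U (fun p => - g p).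
Proof.
move=> Cg; apply: Ck_on_eq (Ck_onM (Ck_on_cst k (-1)) Cg) => p _.
by rewrite mulN1r.
Qed.

Lemma Ck_onX {k g} (n : nat) : Ck_on k U g -> Ck_on k U (fun p => g p ^+ n).
Proof.
move=> Cg; elim: n => [|n IH]; first exact: Ck_on_cst.
by apply: Ck_on_eq (Ck_onM Cg IH) => p _; rewrite exprS.
Qed.

End Ck.

(** * One-sided derivatives at interior points *)

Section HalfLine.
Context {R : realType} {f : R -> R}.

(** All small increments at t > 0 stay in the half-line, so the restriction on
    them is vacuous. *)
Lemma half_increments_gt0 (t : R) : 0 < t -> half_increments t = 0^'.
Proof.
move=> t0; rewrite eqEsubset; split=> P /=; last first.
  by apply: filterS => h Ph _.
have : \forall h \near (0 : R)^', 0 <= t + h.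
  apply: nbhs_dnbhs; near=> h.
  rewrite -lerBlDl sub0r ltW//; near: h; by apply: lt_nbhsr; rewrite oppr_lt0.
by apply: filterS2 => h th; exact.
Unshelve. all: by end_near. Qed.

Lemma is_derive_half_derive (t : R) : half_derivable f t -> 0 < t ->
  is_derive t 1 f (half_derive f t).
Proof.
move=> ft t0; have quotE : (fun h => h^-1 *: ((f \o shift t) (h *: 1) - f t))
    = half_quotient f t.
  by apply/funext => h; rewrite /half_quotient /= [h%:A]mulr1 (addrC t).
move: ft; rewrite /half_derivable /half_derive half_increments_gt0// -quotE.
by move=> ft; split.
Qed.

End HalfLine.

(** * Hamiltonian fields and involution *)

Section Hamiltonian.
Context {R : realType} {m : nat} {M : set 'rV[R]_m}
  {omega : 'rV[R]_m -> 'rV[R]_m -> 'rV[R]_m -> R}.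
Hypothesis somega : symplectic_on M omega.
Implicit Types g h : 'rV[R]_m -> R.

(** The bracket of [g] and [h] is minus the derivative of [h] along the
    Hamiltonian field of [g], hence can be computed from any vector [T] dual to
    the differential of [g]. *)
Lemma hamiltonian_fields_commute {g h} {p T : 'rV[R]_m} : M p ->
  (forall Y, omega p T Y = 'd g p Y) -> 'd h p T = 0 ->
  omega p (hamiltonian_field omega g p) (hamiltonian_field omega h p) = 0.
Proof.
move=> Mp Tg hT; have asym := symp_antisymmetric somega Mp.
have Xg : forall Y, omega p (hamiltonian_field omega g p) Y = 'd g p Y.
  exact: (@xgetPex _ 0 [set X | forall Y, omega p X Y = 'd g p Y]
                   (ex_intro _ T Tg)).
rewrite Xg -Tg asym {1}/hamiltonian_field; case: xgetP => [X _ XE|_].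
  by rewrite XE hT oppr0.
(* Otherwise the field of [h] has the default value 0; use linearity. *)
have := symp_linear somega Mp T (-1) 0 0.
by rewrite -asym scaler0 addr0 mulN1r addNr.
Qed.

Lemma hamiltonian_field_self g p : M p ->
  omega p (hamiltonian_field omega g p) (hamiltonian_field omega g p) = 0.
Proof.
move=> Mp; set X := hamiltonian_field _ _ _.
by have := symp_antisymmetric somega Mp X X; lra.
Qed.

End Hamiltonian.

(** * The form on the phase space *)

Section Torus.
Context {R : realType}.
Implicit Types (f : R -> R) (p X Y Z : 'rV[R]_4).

Lemma y3w2_gt0 {p} : B0_torus p -> 0 < y3w2 p.
Proof.
move=> [y0 w0]; rewrite mulr_gt0 ?exprn_gt0// lt_neqAle addr_ge0 ?sqr_ge0//.
rewrite andbT; apply/negP => /eqP/esym/eqP.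
rewrite paddr_eq0 ?sqr_ge0// !sqrf_eq0 => /andP[/eqP u0 /eqP v0].
exact: w0.
Qed.

Lemma open_B0_torus : open (@B0_torus R).
Proof.
have cc i : continuous (fun p : 'rV[R]_4 => p 0 i) by exact: coord_continuous.
rewrite (_ : B0_torus = @cy R @^-1` [set t | 0 < t] `&`
   ((@cu R @^-1` [set t | t != 0]) `|` (@cv R @^-1` [set t | t != 0]))).
  apply: openI.
    by apply: open_comp; [move=> p _; exact: cc|exact: open_gt].
  by apply: openU; (apply: open_comp; [move=> p _; exact: cc|exact: open_neq]).
apply/seteqP; split=> p /= [y0 w0]; split=> //.
  have [u0|] := eqVneq (cu p) 0; last by left.
  by right; apply/eqP => v0; exact: w0.
by move=> [u0 v0]; case: w0; rewrite ?u0 ?v0 eqxx.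
Qed.

(** The coefficients A, B, C of the form; [omega_zw] is the one shared by the
    four mixed terms. *)
Definition omega_xy f p : R :=
  (- 1 + f (y3w2 p) - 3 * half_derive f (y3w2 p) * y3w2 p) / cy p ^+ 2.

Definition omega_uv f p : R :=
  - (4 / 3 * half_derive f (y3w2 p) * cy p ^+ 3).

Definition omega_zw f p : R :=
  - (2 * cy p ^+ 2 * half_derive f (y3w2 p)).

Lemma omega_fE f p X Y :
  omega_f f p X Y =
    omega_xy f p * wedge (@cx R) (@cy R) X Y
    + omega_uv f p * wedge (@cu R) (@cv R) X Y
    + omega_zw f p *
      (cu p * (wedge (@cx R) (@cu R) X Y + wedge (@cy R) (@cv R) X Y)
       + cv p * (wedge (@cu R) (@cy R) X Y - wedge (@cv R) (@cx R) X Y)).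
Proof.
rewrite /omega_f /omega_xy /omega_uv /omega_zw.
(* Naming the values of f and f' first leaves only the bare factor s to expand. *)
by move: (f (y3w2 p)) (half_derive f (y3w2 p)) => a b; rewrite /y3w2; ring.
Qed.

(** The contribution -3 f' s to A is exactly what cancels the mixed terms:
    both products equal 4 y f'^2 s. *)
Lemma pfaffian_omega_f f p : cy p != 0 ->
  omega_xy f p * omega_uv f p - omega_zw f p ^+ 2 * (cu p ^+ 2 + cv p ^+ 2)
  = 4 / 3 * half_derive f (y3w2 p) * cy p * (1 - f (y3w2 p)).
Proof.
move=> y0; rewrite /omega_xy /omega_uv /omega_zw.
by move: (f (y3w2 p)) (half_derive f (y3w2 p)) => a b; rewrite /y3w2; field.
Qed.

Definition tangent (a b c d : R) : 'rV[R]_4 := \row_i [:: a; b; c; d]`_i.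

Lemma tangentE a b c d :
  ((cx (tangent a b c d) = a) * (cy (tangent a b c d) = b)
   * (cu (tangent a b c d) = c) * (cv (tangent a b c d) = d))%type.
Proof. by rewrite /cx /cy /cu /cv !mxE. Qed.

Lemma coords_eq0 X : cx X = 0 -> cy X = 0 -> cu X = 0 -> cv X = 0 -> X = 0.
Proof.
move=> x0 y0 u0 v0; apply/rowP; case=> [[|[|[|[|//]]]] i4]; rewrite mxE.
- by rewrite -x0; congr (X 0 _); exact: val_inj.
- by rewrite -y0; congr (X 0 _); exact: val_inj.
- by rewrite -u0; congr (X 0 _); exact: val_inj.
- by rewrite -v0; congr (X 0 _); exact: val_inj.
Qed.

Lemma omega_f_scalar f p X : scalar (omega_f f p X).
Proof.
by move=> a Y Z; rewrite !omega_fE /wedge /cx /cy /cu /cv !mxE; ring.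
Qed.

Lemma omega_f_antisymmetric f p X Y : omega_f f p X Y = - omega_f f p Y X.
Proof. by rewrite !omega_fE /wedge; ring. Qed.

Definition dy3w2 p X : R :=
  3 * cy p ^+ 2 * cy X * (cu p ^+ 2 + cv p ^+ 2)
  + 2 * cy p ^+ 3 * (cu p * cu X + cv p * cv X).

(** Along the rotation of w the dx components of the mixed terms cancel, and
    what remains is proportional to ds. *)
Lemma omega_f_rotation f p Y :
  omega_f f p (tangent 0 0 (- cv p) (cu p)) Y
  = 2 / 3 * half_derive f (y3w2 p) * dy3w2 p Y.
Proof.
rewrite omega_fE /wedge !tangentE /omega_uv /omega_zw /dy3w2.
by move: (half_derive f (y3w2 p)) => f'; field.
Qed.

(** * Smoothness and first derivatives *)

Section Smooth.
Variable f : R -> R.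
Hypothesis f_smooth : half_smooth f.

Lemma smooth_on_y3w2 : smooth_on B0_torus (@y3w2 R).
Proof.
have oM := open_B0_torus; move=> k; rewrite /y3w2.
apply: (Ck_onM oM); first by apply: (Ck_onX oM); exact: Ck_on_coord.
by apply: (Ck_onD oM); apply: (Ck_onX oM); exact: Ck_on_coord.
Qed.

Lemma is_derive_iter_half_derive n (t : R) : 0 < t ->
  is_derive t 1 (iter n (@half_derive R) f) (iter n.+1 (@half_derive R) f t).
Proof.
by move=> t0; apply: is_derive_half_derive (f_smooth n t (ltW t0)) t0.
Qed.

Lemma smooth_on_f_y3w2 n :
  smooth_on B0_torus (fun p => iter n (@half_derive R) f (y3w2 p)).
Proof.
move=> k; apply: (Ck_on_comp open_B0_torus (D := [set t | 0 < t]))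
  is_derive_iter_half_derive _ (smooth_on_y3w2 k) n.
exact: @y3w2_gt0.
Qed.

Lemma smooth_on_cyV : smooth_on B0_torus (fun p => (cy p)^-1).
Proof.
move=> k; apply: (Ck_onV open_B0_torus); last exact: Ck_on_coord.
by move=> p [/lt0r_neq0].
Qed.

Lemma smooth_on_omega_f X Y : smooth_on B0_torus (fun p => omega_f f p X Y).
Proof.
have oM := open_B0_torus; move=> k.
have Cs := smooth_on_y3w2 k.
have Cf : Ck_on k B0_torus (fun p => f (y3w2 p)) by exact: smooth_on_f_y3w2 0 k.
have Cf' : Ck_on k B0_torus (fun p => half_derive f (y3w2 p)).
  exact: smooth_on_f_y3w2 1 k.
have Cy : Ck_on k B0_torus (@cy R) by exact: Ck_on_coord.
have Cu : Ck_on k B0_torus (@cu R) by exact: Ck_on_coord.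
have Cv : Ck_on k B0_torus (@cv R) by exact: Ck_on_coord.
have Cc c : Ck_on k B0_torus (fun _ : 'rV[R]_4 => c) by exact: Ck_on_cst.
have Cxy : Ck_on k B0_torus (omega_xy f).
  apply: (Ck_onM oM); first apply: (Ck_onD oM); first exact: (Ck_onD oM).
    by apply: (Ck_onN oM); do 2!apply: (Ck_onM oM) => //.
  apply: (Ck_onV oM) (Ck_onX oM 2 Cy) => p [y0 _].
  by rewrite expf_neq0 ?gt_eqF.
have Cuv : Ck_on k B0_torus (omega_uv f).
  by apply/(Ck_onN oM)/(Ck_onM oM); [exact: (Ck_onM oM)|exact: (Ck_onX oM)].
have Czw : Ck_on k B0_torus (omega_zw f).
  apply/(Ck_onN oM)/(Ck_onM oM) => //.
  by apply: (Ck_onM oM) => //; exact: (Ck_onX oM).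
apply: (Ck_on_eq oM (fun p _ => esym (omega_fE f p X Y))).
apply: (Ck_onD oM); first by apply: (Ck_onD oM); exact: (Ck_onM oM).
by apply: (Ck_onM oM) => //; apply: (Ck_onD oM); exact: (Ck_onM oM).
Qed.

Lemma smooth_on_H1 : smooth_on B0_torus (H1 f).
Proof.
move=> k; rewrite /H1; apply: (Ck_onM open_B0_torus); first exact: Ck_on_cst.
exact: smooth_on_f_y3w2 0 k.
Qed.

Lemma smooth_on_H2 : smooth_on B0_torus (H2 f).
Proof.
have oM := open_B0_torus; move=> k; rewrite /H2.
apply: (Ck_onM oM); first apply: (Ck_onM oM); first exact: Ck_on_cst.
  by apply: (Ck_onM oM); [exact: Ck_on_coord|exact: smooth_on_cyV].
apply: (Ck_onD oM); first exact: Ck_on_cst.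
by apply: (Ck_onN oM); exact: smooth_on_f_y3w2 0 k.
Qed.

Section Derivatives.
Variables (p X : 'rV[R]_4).
Hypothesis Mp : B0_torus p.

Let y0 : cy p != 0. Proof. by have [/lt0r_neq0] := Mp. Qed.

#[local] Instance is_derive_cx : is_derive p X (@cx R) (cx X).
Proof. exact: is_derive_coord. Qed.
#[local] Instance is_derive_cy : is_derive p X (@cy R) (cy X).
Proof. exact: is_derive_coord. Qed.
#[local] Instance is_derive_cu : is_derive p X (@cu R) (cu X).
Proof. exact: is_derive_coord. Qed.
#[local] Instance is_derive_cv : is_derive p X (@cv R) (cv X).
Proof. exact: is_derive_coord. Qed.

#[local] Instance is_derive_y3w2 : is_derive p X (@y3w2 R) (dy3w2 p X).
Proof.
by rewrite /y3w2; apply: is_derive_eq; rewrite /dy3w2 /GRing.scale /=; ring.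
Qed.

Lemma is_derive_f_y3w2 n :
  is_derive p X (fun q => iter n (@half_derive R) f (y3w2 q))
    (iter n.+1 (@half_derive R) f (y3w2 p) * dy3w2 p X).
Proof.
apply: is_derive_comp_real is_derive_y3w2 _; first exact: (smooth_on_y3w2 1).1.
exact/is_derive_iter_half_derive/y3w2_gt0.
Qed.

#[local] Instance is_derive_f_y3w2_0 : is_derive p X (fun q => f (y3w2 q))
  (half_derive f (y3w2 p) * dy3w2 p X).
Proof. exact: is_derive_f_y3w2 0. Qed.
#[local] Instance is_derive_f_y3w2_1 :
  is_derive p X (fun q => half_derive f (y3w2 q))
  (half_derive (half_derive f) (y3w2 p) * dy3w2 p X).
Proof. exact: is_derive_f_y3w2 1. Qed.

(** The f' terms of the derivative of - 1 + f - 3 f' s combine to -2 f', because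
    s is differentiated both inside f and as a factor. *)
Lemma is_derive_omega_xy : is_derive p X (omega_xy f)
  (- (2 * half_derive f (y3w2 p)
      + 3 * half_derive (half_derive f) (y3w2 p) * y3w2 p)
      * dy3w2 p X / cy p ^+ 2
   - 2 * omega_xy f p * cy X / cy p).
Proof.
have Dy2V : is_derive p X (fun q => (cy q ^+ 2)^-1) (- 2 * cy X / cy p ^+ 3).
  have Dy2 : is_derive p X (fun q => cy q ^+ 2) (2 * cy p * cy X).
    by apply: is_derive_eq; rewrite /GRing.scale /=; ring.
  have := is_derive_inv (g := fun q => cy q ^+ 2) (expf_neq0 2 y0) Dy2.
  by move=> /is_derive_eq; apply; field.
rewrite /omega_xy; apply: is_derive_eq; rewrite /GRing.scale /=.
move: (f (y3w2 p)) (half_derive f (y3w2 p))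
  (half_derive (half_derive f) (y3w2 p)) (dy3w2 p X).
by move: (y3w2 p) => s a b c ds; field.
Qed.

Lemma is_derive_omega_uv : is_derive p X (omega_uv f)
  (- (4 / 3) * (half_derive (half_derive f) (y3w2 p) * dy3w2 p X * cy p ^+ 3
                + 3 * half_derive f (y3w2 p) * cy p ^+ 2 * cy X)).
Proof.
rewrite /omega_uv; apply: is_derive_eq; rewrite /GRing.scale /=.
by move: (half_derive f (y3w2 p))
  (half_derive (half_derive f) (y3w2 p)) => b c; field.
Qed.

Lemma is_derive_omega_zw : is_derive p X (omega_zw f)
  (- 2 * (2 * cy p * cy X * half_derive f (y3w2 p)
          + cy p ^+ 2 * half_derive (half_derive f) (y3w2 p) * dy3w2 p X)).
Proof.
rewrite /omega_zw; apply: is_derive_eq; rewrite /GRing.scale /=.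
by move: (half_derive f (y3w2 p))
  (half_derive (half_derive f) (y3w2 p)) => b c; ring.
Qed.

Lemma is_derive_omega_f Y Z : is_derive p X (fun q => omega_f f q Y Z)
  ('D_X (omega_xy f) p * wedge (@cx R) (@cy R) Y Z
   + 'D_X (omega_uv f) p * wedge (@cu R) (@cv R) Y Z
   + ('D_X (omega_zw f) p * cu p + omega_zw f p * cu X)
     * (wedge (@cx R) (@cu R) Y Z + wedge (@cy R) (@cv R) Y Z)
   + ('D_X (omega_zw f) p * cv p + omega_zw f p * cv X)
     * (wedge (@cu R) (@cy R) Y Z - wedge (@cv R) (@cx R) Y Z)).
Proof.
have [/derivableP Dxy _] := is_derive_omega_xy.
have [/derivableP Duv _] := is_derive_omega_uv.
have [/derivableP Dzw _] := is_derive_omega_zw.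
under eq_fun do rewrite omega_fE.
by apply: is_derive_eq; rewrite /GRing.scale /=; ring.
Qed.

Lemma diff_H1 : 'd (H1 f) p X = 2 / 3 * half_derive f (y3w2 p) * dy3w2 p X.
Proof.
rewrite -deriveE; last exact: (smooth_on_H1 1).1.
apply: derive_val; rewrite /H1; apply: is_derive_eq; rewrite /GRing.scale /=.
by move: (half_derive f (y3w2 p)) => b; ring.
Qed.

Lemma diff_H2 : 'd (H2 f) p X =
  2 * (cx X / cy p - cx p * cy X / cy p ^+ 2) * (1 - f (y3w2 p))
  - 2 * (cx p / cy p) * half_derive f (y3w2 p) * dy3w2 p X.
Proof.
rewrite -deriveE; last exact: (smooth_on_H2 1).1.
have DyV := is_derive_inv y0 is_derive_cy.
apply: derive_val; rewrite /H2; apply: is_derive_eq; rewrite /GRing.scale /=.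
by move: (f (y3w2 p)) (half_derive f (y3w2 p)) => a b; field.
Qed.

End Derivatives.

(** The scalars f, f', f'' enter only through their values at s: once the
    derivatives of A, B, C are inserted, closedness is a rational identity in
    these values, the coordinates and the components of the three vectors. *)
Lemma ext_derive2_omega_f p X Y Z : B0_torus p ->
  ext_derive2 (omega_f f) p X Y Z = 0.
Proof.
move=> Mp; have [/lt0r_neq0 y0 _] := Mp; rewrite /ext_derive2.
rewrite !(@derive_val _ _ _ _ _ _ _ (is_derive_omega_f _ _ Mp _ _)).
rewrite !(@derive_val _ _ _ _ _ _ _ (is_derive_omega_xy _ _ Mp)).
rewrite !(@derive_val _ _ _ _ _ _ _ (is_derive_omega_uv _ _ Mp)).
rewrite !(@derive_val _ _ _ _ _ _ _ (is_derive_omega_zw _ _ Mp)).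
rewrite /omega_xy /omega_zw /dy3w2 /wedge.
move: (f (y3w2 p)) (half_derive f (y3w2 p))
  (half_derive (half_derive f) (y3w2 p)) => a b c; rewrite /y3w2.
by field.
Qed.

End Smooth.

(** * Nondegeneracy and independence *)

Section Main.
Variable f : R -> R.
Hypothesis f_le0 : forall t : R, 0 <= t -> f t <= 0.
Hypothesis f_smooth : half_smooth f.
Hypothesis f'_lt0 : forall t : R, 0 <= t -> half_derive f t < 0.

(** A 4 x 4 antisymmetric matrix times its Pfaffian adjoint is the Pfaffian
    times the identity; the four test vectors are the columns of that adjoint,
    so pairing [X] with them gives the Pfaffian times its coordinates. *)
Lemma omega_f_nondegenerate p X : B0_torus p ->
  (forall Y, omega_f f p X Y = 0) -> X = 0.
Proof.
move=> Mp oX; have [y_gt0 _] := Mp; have s_ge0 := ltW (y3w2_gt0 Mp).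
have y0 := lt0r_neq0 y_gt0.
pose pf := 4 / 3 * half_derive f (y3w2 p) * cy p * (1 - f (y3w2 p)).
have pf0 : pf != 0.
  rewrite !mulf_neq0 ?invr_neq0 ?pnatr_eq0 ?(ltr0_neq0 (f'_lt0 _ s_ge0))//.
  by have := f_le0 _ s_ge0; lra.
have pfE := pfaffian_omega_f f p y0; rewrite -/pf in pfE.
set a := omega_xy f p in pfE; set b := omega_uv f p in pfE.
set c := omega_zw f p in pfE.
have oE Y := omega_fE f p X Y.
have divpf (t : R) : pf * t = 0 -> t = 0.
  by move/eqP; rewrite mulf_eq0 (negPf pf0) => /eqP.
apply: coords_eq0; apply: divpf; rewrite -pfE.
- rewrite -[RHS](oX (tangent 0 b (- c * cu p) (- c * cv p))).
  by rewrite oE /wedge !tangentE -/a -/b -/c; ring.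
- rewrite -[RHS](oX (tangent (- b) 0 (c * cv p) (- c * cu p))).
  by rewrite oE /wedge !tangentE -/a -/b -/c; ring.
- rewrite -[RHS](oX (tangent (c * cu p) (- c * cv p) 0 a)).
  by rewrite oE /wedge !tangentE -/a -/b -/c; ring.
- rewrite -[RHS](oX (tangent (c * cv p) (c * cu p) (- a) 0)).
  by rewrite oE /wedge !tangentE -/a -/b -/c; ring.
Qed.

Lemma symplectic_omega_f : symplectic_on B0_torus (omega_f f).
Proof.
split=> [|p _ X|p _ X Y|X Y|p Mp X|p Mp X Y Z].
- exact: open_B0_torus.
- exact: omega_f_scalar.
- exact: omega_f_antisymmetric.
- exact: smooth_on_omega_f.
- exact: omega_f_nondegenerate.
- exact: ext_derive2_omega_f.
Qed.

Lemma rotation_hamiltonian_H1 p Y : B0_torus p ->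
  omega_f f p (tangent 0 0 (- cv p) (cu p)) Y = 'd (H1 f) p Y.
Proof. by move=> Mp; rewrite omega_f_rotation diff_H1. Qed.

Lemma diff_H2_rotation p : B0_torus p ->
  'd (H2 f) p (tangent 0 0 (- cv p) (cu p)) = 0.
Proof. by move=> Mp; rewrite diff_H2// /dy3w2 !tangentE; ring. Qed.

(** Testing on d_x isolates c2, since dH1 has no dx component; testing on d_y
    then isolates c1. *)
Lemma H1_H2_independent p (c1 c2 : R) : B0_torus p ->
  (forall Y, c1 * 'd (H1 f) p Y + c2 * 'd (H2 f) p Y = 0) -> c1 = 0 /\ c2 = 0.
Proof.
move=> Mp c12; have [y_gt0 _] := Mp; have s_gt0 := y3w2_gt0 Mp.
have s_ge0 := ltW s_gt0; have y0 := lt0r_neq0 y_gt0.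
have f10 : 1 - f (y3w2 p) != 0 by have := f_le0 _ s_ge0; lra.
have f'0 := ltr0_neq0 (f'_lt0 _ s_ge0).
have c20 : c2 = 0.
  have := c12 (tangent 1 0 0 0).
  rewrite diff_H1// diff_H2// /dy3w2 !tangentE.
  rewrite !(mulr0, mul0r, addr0, subr0) add0r.
  move/eqP; rewrite mulf_eq0 => /orP[/eqP//|].
  by rewrite !mulf_eq0 invr_eq0 oner_eq0 pnatr_eq0 (negPf y0) (negPf f10).
split=> //; have := c12 (tangent 0 1 0 0).
rewrite c20 mul0r addr0 diff_H1// /dy3w2 !tangentE.
have -> : c1 * (2 / 3 * half_derive f (y3w2 p) *
    (3 * cy p ^+ 2 * 1 * (cu p ^+ 2 + cv p ^+ 2)
     + 2 * cy p ^+ 3 * (cu p * 0 + cv p * 0)))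
    = c1 * (2 * half_derive f (y3w2 p) * y3w2 p / cy p).
  by move: (half_derive f (y3w2 p)) => b; rewrite /y3w2; field.
have d0 : 2 * half_derive f (y3w2 p) * y3w2 p / cy p != 0.
  rewrite mulf_neq0 ?invr_neq0// mulf_neq0 ?(lt0r_neq0 s_gt0)//.
  by rewrite mulf_neq0 ?pnatr_eq0.
by move/eqP; rewrite mulf_eq0 (negPf d0) orbF => /eqP.
Qed.

End Main.

End Torus.

(** * Complete integrability *)

Theorem proposition4p6 (R : realType) (f : R -> R)
  (f_le0 : forall t : R, 0 <= t -> f t <= 0)
  (f_smooth : half_smooth f)
  (f_0 : f 0 = 0)
  (f'_lt0 : forall t : R, 0 <= t -> half_derive f t < 0)
  (f_lim : f t @[t --> +oo] --> -oo) :
  completely_integrable B0_torus (omega_f f) (H1 f) [tuple H1 f; H2 f].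
Proof.
have somega := symplectic_omega_f f f_le0 f_smooth f'_lt0.
have H12 p : B0_torus p -> omega_f f p
    (hamiltonian_field (omega_f f) (H1 f) p)
    (hamiltonian_field (omega_f f) (H2 f) p) = 0.
  move=> Mp; apply: (hamiltonian_fields_commute somega Mp) => [Y|].
    exact: rotation_hamiltonian_H1.
  exact: diff_H2_rotation.
have I2 (i : 'I_2) : i = ord0 \/ i = lift ord0 ord0.
  by case: i => [[|[|//]] i2]; [left|right]; exact: val_inj.
have F0 : tnth [tuple H1 f; H2 f] ord0 = H1 f by [].
have F1 : tnth [tuple H1 f; H2 f] (lift ord0 ord0) = H2 f by [].
split.
- by [].
- by split; [exact: somega|exact: smooth_on_H1].
- by rewrite theadE.
- by move=> i; have [->|->] := I2 i; [exact: smooth_on_H1|exact: smooth_on_H2].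
- move=> p Mp c cF.
  have [Y|c0 c1] := H1_H2_independent f f_le0 f_smooth f'_lt0 p
                      (c ord0) (c (lift ord0 ord0)) Mp.
    by have := cF Y; rewrite big_ord_recl big_ord1.
  by move=> i; have [->|->] := I2 i.
- move=> i j p Mp; have [->|->] := I2 i; have [->|->] := I2 j; rewrite ?F0 ?F1.
  + exact: (hamiltonian_field_self somega).
  + exact: H12.
  + by rewrite (symp_antisymmetric somega Mp) H12 ?oppr0.
  + exact: (hamiltonian_field_self somega).
Qed.
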